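(* Let $n\ge 3$, $X=\{1,\dots,n\}$, and let $p^*$ and $p$ be probability measures on the power set of $X$, with $p(i)>0$ for all $i\in X$. The following are equivalent: (A) There exist functions $f_1,f_2\colon X\to\mathbb{R}$ such that the decision $\mathbb{E}_{p^*}[f_1]>\mathbb{E}_{p^*}[f_2]$ is conditionally $p$-inaccessible. (B) $p^*$ is in the Bayes $p$-Blind Spot, i.e. $q_\Pi\neq p^*$ for every proper non-trivial partition $\Pi$ of $X$.
   Context: For a probability measure $q$ on the power set of $X=\{1,\dots,n\}$ write $q(i)=q(\{i\})$, and for $f\colon X\to\mathbb{R}$ write $\mathbb{E}_q[f]=\sum_{i=1}^n f(i)q(i)$. A partition $\Pi=\{B_1,\dots,B_m\}$ of $X$ into nonempty pairwise disjoint blocks with union $X$ is called proper non-trivial if $2\le m\le n-1$. $\mathfrak{P}$ denotes the set of all proper non-trivial partitions of $X$. For a partition $\Pi$ of $X$, the Jeffrey posterior $q_\Pi$ of $p$ determined by $\Pi$ (and $p^*$) is the probability measure on $X$ given by $q_\Pi(i)=p^*(B)\,\dfrac{p(i)}{p(B)}$ for $i\in B\in\Pi$. For $f_1,f_2\colon X\to\mathbb{R}$ with $d=f_1-f_2$ not strictly positive at every point of $X$ (all decision contexts are assumed non-trivial in this sense), the decision $\mathbb{E}_{p^*}[f_1]>\mathbb{E}_{p^*}[f_2]$, i.e. $\mathbb{E}_{p^*}[d]>0$, is called conditionally $p$-inaccessible if (that inequality holds and) $\mathbb{E}_{q_\Pi}[d]\le 0$ for all $\Pi\in\mathfrak{P}$.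 *)

(* Defs.v *)
From HB Require Import structures.
From mathcomp Require Import all_boot all_order all_algebra.
From mathcomp Require Import all_classical all_reals all_analysis.

Set Implicit Arguments.
Unset Strict Implicit.
Unset Printing Implicit Defensive.

Import Order.TTheory GRing.Theory Num.Theory.

Local Open Scope classical_set_scope.
Local Open Scope ring_scope.

(* The set X = {1, ..., N} is rendered as 'I_n.+1, i.e. N = n.+1: measurable
   types are pointed, so X has to be syntactically nonempty.  Its sigma-algebra
   is the full power set. *)
HB.instance Definition _ (n : nat) := isPointed.Build 'I_n.+1 ord0.

HB.instance Definition _ (n : nat) :=
  @isMeasurable.Build default_measure_display 'I_n.+1 discrete_measurable
    discrete_measurable0 discrete_measurableC discrete_measurableU.

Section pointwise.
Context {R : realType} {n : nat}.
Implicit Types (q : probability 'I_n.+1 R) (i : 'I_n.+1) (B : {set 'I_n.+1}).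

Definition prob q B : R := fine (q [set` B]).

Definition mass q i : R := fine (q [set i]).

Definition expect q (f : 'I_n.+1 -> R) : R := \sum_i f i * mass q i.

Lemma mass_ge0 q i : 0 <= mass q i.
Proof. exact: fine_ge0. Qed.

Lemma prob_ge0 q B : 0 <= prob q B.
Proof. exact: fine_ge0. Qed.

Lemma prob_fineK q B : (prob q B)%:E = q [set` B].
Proof. by rewrite fineK// fin_num_measure. Qed.

Lemma prob_sum q B : prob q B = \sum_(i in B) mass q i.
Proof.
apply: EFin_inj; rewrite prob_fineK -sumEFin.
have -> : [set` B] = \big[setU/set0]_(i in B) [set i].
  apply/seteqP; split=> [x /= xB|x]; rewrite -bigcup_seq_cond/=.
    by exists x => //=; rewrite mem_index_enum.
  by move=> [i /=/andP[_ iB] ->].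
rewrite measure_bigsetU_ord_cond//; last by move=> i j _ _ [x [/= -> ->]].
by apply: eq_bigr => i _; rewrite /mass fineK// fin_num_measure.
Qed.

Lemma prob_setT q : prob q [set: 'I_n.+1]%SET = 1.
Proof.
apply: EFin_inj; rewrite prob_fineK -(probability_setT q); congr (q _).
by apply/seteqP; split=> x //=; rewrite inE.
Qed.

End pointwise.

(* [partition] alone would denote the indexed families of classical_sets. *)
Definition is_partition {n : nat} (Pi : {set {set 'I_n.+1}}) : bool :=
  finset.partition Pi [set: 'I_n.+1]%SET.

Section jeffrey.
Context {R : realType} {n : nat}.
Implicit Types (ps p : probability 'I_n.+1 R) (Pi : {set {set 'I_n.+1}}).

Definition jeffrey_mass ps p Pi (i : 'I_n.+1) : R :=
  let B := finset.pblock Pi i in prob ps B * (mass p i / prob p B).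

(* The two hypotheses are used only to show that the total mass is 1. *)
Definition jeffrey ps p (p_gt0 : forall i, 0 < mass p i) Pi
    (partPi : is_partition Pi) (A : set 'I_n.+1) : \bar R :=
  (\sum_(i | i \in A) jeffrey_mass ps p Pi i)%:E.

Lemma jeffrey_mass_ge0 ps p Pi i : 0 <= jeffrey_mass ps p Pi i.
Proof. by rewrite mulr_ge0 ?divr_ge0 ?prob_ge0 ?mass_ge0. Qed.

Section jeffrey_measure.
Context ps p (p_gt0 : forall i, 0 < mass p i) Pi
  (partPi : is_partition Pi).

Let jeffrey0 : jeffrey ps p_gt0 partPi set0 = 0%E.
Proof. by rewrite /jeffrey big1// => i; rewrite in_set0. Qed.

Let jeffrey_ge0 A : (0 <= jeffrey ps p_gt0 partPi A)%E.
Proof. by rewrite lee_fin sumr_ge0// => i _; exact: jeffrey_mass_ge0. Qed.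

Let jeffrey_sigma_additive : semi_sigma_additive (jeffrey ps p_gt0 partPi).
Proof.
pose m k : {measure set 'I_n.+1 -> \bar R} :=
  mscale (NngNum (jeffrey_mass_ge0 ps p Pi (inord k))) (dirac (inord k)).
suff -> : jeffrey ps p_gt0 partPi = msum m n.+1.
  exact: measure_semi_sigma_additive.
apply/funext => A; rewrite /jeffrey /msum -sumEFin [LHS]big_mkcond/=.
apply: eq_bigr => i _; rewrite /m /= /mscale/= inord_val diracE.
by case: ifP => _; rewrite ?mule1 ?mule0.
Qed.

HB.instance Definition _ := isMeasure.Build _ _ _ (jeffrey ps p_gt0 partPi)
  jeffrey0 jeffrey_ge0 jeffrey_sigma_additive.

Let jeffreyT : jeffrey ps p_gt0 partPi setT = 1%E.
Proof.
have /and3P[/eqP covPi trivPi _] := partPi.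
rewrite /jeffrey -(prob_setT ps) prob_sum; congr EFin.
transitivity (\sum_(i in [set: 'I_n.+1]%SET) jeffrey_mass ps p Pi i).
  by apply: eq_bigl => i; rewrite in_setT finset.in_setT.
rewrite -covPi !finset.big_trivIset//=; apply: eq_bigr => B BPi.
rewrite -prob_sum; under eq_bigr => i iB.
  rewrite /jeffrey_mass (finset.def_pblock trivPi BPi iB); over.
rewrite -mulr_sumr -mulr_suml -prob_sum divff ?mulr1//.
have [i iB] : exists i, i \in B.
  by apply/finset.set0Pn; have := finset.partition_neq0 partPi BPi.
rewrite gt_eqF// prob_sum (bigD1 i)//= ltr_pwDl//.
by apply: sumr_ge0 => j _; exact: mass_ge0.
Qed.

HB.instance Definition _ :=
  Measure_isProbability.Build _ _ _ (jeffrey ps p_gt0 partPi) jeffreyT.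

End jeffrey_measure.

Definition jeffrey_posterior ps p (p_gt0 : forall i, 0 < mass p i) Pi
    (partPi : is_partition Pi) : probability 'I_n.+1 R :=
  jeffrey ps p_gt0 partPi.

Lemma mass_jeffrey_posterior ps p (p_gt0 : forall i, 0 < mass p i) Pi
    (partPi : is_partition Pi) (B : {set 'I_n.+1}) i :
  B \in Pi -> i \in B ->
  mass (jeffrey_posterior ps p_gt0 partPi) i =
    prob ps B * (mass p i / prob p B).
Proof.
move=> BPi iB; have /and3P[_ trivPi _] := partPi.
transitivity (jeffrey_mass ps p Pi i).
  rewrite /mass -[LHS]/(\sum_(j | j \in [set i]) jeffrey_mass ps p Pi j).
  by apply: big_pred1 => j; apply/idP/eqP => [|->]; rewrite inE.
by rewrite /jeffrey_mass (finset.def_pblock trivPi BPi iB).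
Qed.

End jeffrey.

Definition proper_nontrivial {n : nat} (Pi : {set {set 'I_n.+1}}) : bool :=
  (2 <= #|Pi| <= n.+1 - 1)%N.

Section decision.
Context {R : realType} {n : nat}.
Implicit Types (ps p : probability 'I_n.+1 R) (f : 'I_n.+1 -> R).

Definition nontrivial_context f1 f2 : Prop := ~ (forall i, 0 < f1 i - f2 i).

Definition conditionally_inaccessible ps p (p_gt0 : forall i, 0 < mass p i)
    f1 f2 : Prop :=
  expect ps f2 < expect ps f1 /\
  forall Pi (partPi : is_partition Pi), proper_nontrivial Pi ->
    expect (jeffrey_posterior ps p_gt0 partPi) (f1 \- f2) <= 0.

Definition blind_spot p (p_gt0 : forall i, 0 < mass p i) ps : Prop :=
  forall Pi (partPi : is_partition Pi), proper_nontrivial Pi ->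
    jeffrey_posterior ps p_gt0 partPi <> ps.

End decision.

(* Main.v *)
(** With the likelihood ratio [r = ps/p], the posterior [q_Pi] has density
    [E_p[r | Pi]] with respect to [p], so [E_(q_Pi)[r]] is the squared
    [L^2(p)]-norm of the orthogonal projection of [r] on the [Pi]-measurable
    functions, and
    [E_ps[r] - E_(q_Pi)[r] = \sum_i (ps(i) - q_Pi(i))^2 / p(i)].
    This is positive as soon as [q_Pi <> ps].  In the blind spot,
    [d = r - c] with [c] the maximum of [E_(q_Pi)[r]] over the finitely many
    proper non-trivial [Pi] therefore has positive expectation under [ps] and
    nonpositive expectation under each [q_Pi]; it is not strictly positive since
    its expectation vanishes at a maximizing [Pi]. *)

Require Import Defs.
From mathcomp Require Import all_boot all_order all_algebra.
From mathcomp Require Import all_classical all_reals all_analysis.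
From mathcomp Require Import ring.
Import Order.TTheory GRing.Theory Num.Theory.
Local Open Scope classical_set_scope.
Local Open Scope ring_scope.

(** Apart from the set function, a probability carries only proofs of propositions, which proof
    irrelevance identifies. *)
Lemma eq_probability d (T : measurableType d) (R : realType)
    (q1 q2 : probability T R) :
  (q1 : set T -> \bar R) = q2 -> q1 = q2.
Proof.
case: q1 => f1 [[a1 a2] [a3] [a4] [a5] [a6] [a7] [a8]].
(* The proof fields stay in the goal, so that rewriting with [e] turns them into statements about
   [f1]. *)
case: q2 => f2 [[+ +] [+] [+] [+] [+] [+] [+]] /= e.
rewrite -{}e => b1 b2 b3 b4 b5 b6 b7 b8.
rewrite (Prop_irrelevance b1 a1) (Prop_irrelevance b2 a2).
rewrite (Prop_irrelevance b3 a3) (Prop_irrelevance b4 a4).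
rewrite (Prop_irrelevance b5 a5) (Prop_irrelevance b6 a6).
by rewrite (Prop_irrelevance b7 a7) (Prop_irrelevance b8 a8).
Qed.

Section mass_expect.
Context {R : realType} {n : nat}.
Implicit Types (q : probability 'I_n.+1 R) (f g : 'I_n.+1 -> R).

Lemma sum_mass q : \sum_i mass q i = 1.
Proof.
by rewrite -(prob_setT q) prob_sum; apply: eq_bigl => i; rewrite finset.in_setT.
Qed.

Lemma eq_mass q1 q2 : mass q1 =1 mass q2 -> q1 = q2.
Proof.
move=> eq_q; apply: eq_probability; apply/funext => A.
have -> : A = [set` finset.finset (mem A)].
  by apply/seteqP; split=> x /=; rewrite !inE.
rewrite -!prob_fineK !prob_sum; congr EFin.
by apply: eq_bigr => i _; exact: eq_q.
Qed.

Lemma expectB q f g : expect q (f \- g) = expect q f - expect q g.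
Proof. by rewrite /expect -sumrB; apply: eq_bigr => i _; rewrite mulrBl. Qed.

Lemma expect_cst q (c : R) : expect q (fun=> c) = c.
Proof. by rewrite /expect -mulr_sumr sum_mass mulr1. Qed.

(** Some masses may be zero, but not all of them, since they sum to 1. *)
Lemma expect_gt0 q f : (forall i, 0 < f i) -> 0 < expect q f.
Proof.
move=> f_gt0; have fq_ge0 i : true -> 0 <= f i * mass q i.
  by move=> _; rewrite mulr_ge0 ?mass_ge0// ltW.
rewrite lt_def sumr_ge0// andbT; apply/eqP => /(psumr_eq0P fq_ge0) fq0.
suff : \sum_i mass q i = 0 by rewrite sum_mass => /eqP; rewrite oner_eq0.
apply: big1 => i _; move/eqP: (fq0 i isT).
by rewrite mulf_eq0 gt_eqF//= => /eqP.
Qed.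

End mass_expect.

Section likelihood_ratio.
Context {R : realType} {n : nat} (ps p : probability 'I_n.+1 R)
  (p_gt0 : forall i, 0 < mass p i).

Definition likelihood_ratio (i : 'I_n.+1) : R := mass ps i / mass p i.

Lemma mass_jeffrey_posteriorE Pi (partPi : is_partition Pi) :
  mass (jeffrey_posterior ps p_gt0 partPi) =1 jeffrey_mass ps p Pi.
Proof.
move=> i; have /and3P[/eqP covPi _ _] := partPi.
have i_cov : i \in finset.cover Pi by rewrite covPi finset.in_setT.
by rewrite (@mass_jeffrey_posterior _ _ _ _ _ _ _ (finset.pblock Pi i))
  ?finset.mem_pblock ?finset.pblock_mem.
Qed.

Lemma prob_gt0 (B : {set 'I_n.+1}) : B != finset.set0 -> 0 < prob p B.
Proof.
move=> /finset.set0Pn[i iB]; rewrite prob_sum (bigD1 i)//= ltr_pwDl//.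
by apply: sumr_ge0 => j _; exact: mass_ge0.
Qed.

(** This is the orthogonality of [r - q/p] and [q/p] in $L^2(p)$: the density [q/p] is constant on
    each block, and [q] and [ps] give each block the same probability. *)
Lemma expect_jeffrey_likelihood_ratio Pi (partPi : is_partition Pi) :
  let q := jeffrey_posterior ps p_gt0 partPi in
  expect q likelihood_ratio = \sum_i mass q i ^+ 2 / mass p i.
Proof.
move=> q; have bigPi F : \sum_i F i = \sum_(B in Pi) \sum_(i in B) F i :> R.
  rewrite -(finset.set_partition_big _ partPi).
  by apply: eq_bigl => i; rewrite finset.in_setT.
rewrite /expect !bigPi; apply: eq_bigr => B BPi.
have pB_gt0 : 0 < prob p B by apply/prob_gt0/(finset.partition_neq0 partPi).
have qE i : i \in B -> mass q i = prob ps B * (mass p i / prob p B).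
  exact: mass_jeffrey_posterior.
(* Both sides equal [ps(B)^2 / p(B)]. *)
transitivity (\sum_(i in B) prob ps B / prob p B * mass ps i).
  apply: eq_bigr => i iB; rewrite /likelihood_ratio qE//.
  by field; rewrite !gt_eqF.
rewrite -mulr_sumr -prob_sum.
transitivity (\sum_(i in B) (prob ps B / prob p B) ^+ 2 * mass p i); last first.
  by apply: eq_bigr => i iB; rewrite qE//; field; rewrite !gt_eqF.
by rewrite -mulr_sumr -prob_sum; field; rewrite gt_eqF.
Qed.

Lemma expect_likelihood_ratioB Pi (partPi : is_partition Pi) :
  let q := jeffrey_posterior ps p_gt0 partPi in
  expect ps likelihood_ratio - expect q likelihood_ratio =
    \sum_i (mass ps i - mass q i) ^+ 2 / mass p i.
Proof.
move=> q; have qr := expect_jeffrey_likelihood_ratio _ partPi.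
(* The added term is zero; it completes the square, turning [ps^2/p - ps q/p] into
   [ps^2/p - 2 ps q/p + q^2/p] pointwise. *)
transitivity (expect ps likelihood_ratio - expect q likelihood_ratio +
    (\sum_i mass q i ^+ 2 / mass p i - expect q likelihood_ratio)).
  by rewrite -qr subrr addr0.
rewrite /expect -!sumrB -big_split/=; apply: eq_bigr => i _.
by rewrite /likelihood_ratio; field; rewrite gt_eqF.
Qed.

Lemma expect_likelihood_ratio_lt Pi (partPi : is_partition Pi) :
  let q := jeffrey_posterior ps p_gt0 partPi in
  q <> ps -> expect q likelihood_ratio < expect ps likelihood_ratio.
Proof.
move=> q q_ps; rewrite -subr_gt0 expect_likelihood_ratioB.
have sq_ge0 i : true -> 0 <= (mass ps i - mass q i) ^+ 2 / mass p i.
  by move=> _; rewrite divr_ge0 ?sqr_ge0 ?mass_ge0.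
rewrite lt_def sumr_ge0// andbT; apply/eqP => /(psumr_eq0P sq_ge0) sq0.
apply: q_ps; apply: eq_mass => i; apply/eqP; rewrite eq_sym -subr_eq0.
move/eqP: (sq0 i isT).
by rewrite mulf_eq0 sqrf_eq0 invr_eq0 [mass p i == 0]gt_eqF// orbF.
Qed.

End likelihood_ratio.

(** Needed for the maximum over partitions to exist. A singleton and its complement form two blocks,
    and [2 <= n.+1 - 1] is the bound on [n]. *)
Lemma exists_proper_nontrivial_partition (n : nat) : (3 <= n.+1)%N ->
  exists Pi : {set {set 'I_n.+1}}, is_partition Pi && proper_nontrivial Pi.
Proof.
move=> n_ge3; pose A : {set 'I_n.+1} := [set ord0]%SET.
have max_nA : ord_max \in (~: A)%SET.
  by rewrite !inE -val_eqE /= -lt0n -ltnS ltnW.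
have A_in0 : ord0 \in A by rewrite finset.in_set1.
have AC : A != (~: A)%SET.
  by apply: contraTneq A_in0 => ->; rewrite finset.in_setC finset.in_set1 eqxx.
exists [set A; (~: A)%SET]%SET.
rewrite /proper_nontrivial cards2 AC subn1 [(_ <= n.+1.-1)%N]n_ge3 /= andbT.
have A0 : A != finset.set0 by apply/finset.set0Pn; exists ord0.
have CA0 : (~: A)%SET != finset.set0 by apply/finset.set0Pn; exists ord_max.
apply/and3P; split.
- by rewrite /finset.cover big_setU1 ?big_set1 ?finset.in_set1//= finset.setUCr.
- have [] // := @finset.trivIsetU1 _ A [set (~: A)%SET]%SET.
  + by move=> B /finset.set1P->; rewrite -setI_eq0 finset.setICr.
  + apply/finset.trivIsetP => B C /finset.set1P-> /finset.set1P->.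
    by rewrite eqxx.
  + by rewrite finset.in_set1 eq_sym.
- by rewrite !inE !(eq_sym finset.set0) negb_or A0.
Qed.

Theorem theorem3p2 (R : realType) (n : nat) (n_ge3 : (3 <= n.+1)%N)
    (ps p : probability 'I_n.+1 R) (p_gt0 : forall i, 0 < mass p i) :
  (exists f1 f2 : 'I_n.+1 -> R,
     nontrivial_context f1 f2 /\ conditionally_inaccessible ps p_gt0 f1 f2)
  <-> blind_spot p_gt0 ps.
Proof.
split=> [[f1 [f2 [_ [f_lt f_le]]]] Pi partPi propPi q_ps|blind].
  by have := f_le _ partPi propPi; rewrite q_ps expectB subr_le0 leNgt f_lt.
have [Pi0 Pi0P] := exists_proper_nontrivial_partition _ n_ge3.
pose r := likelihood_ratio ps p.
(* The posterior requires a proof that [Pi] is a partition; [jeffrey_mass] does not, so [F] is total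
   and can be maximized by [arg_maxP]. *)
pose F Pi := \sum_i r i * jeffrey_mass ps p Pi i.
have FE Pi (partPi : is_partition Pi) :
    F Pi = expect (jeffrey_posterior ps p_gt0 partPi) r.
  by apply: eq_bigr => i _; rewrite mass_jeffrey_posteriorE.
pose P (Pi : {set {set 'I_n.+1}}) := is_partition Pi && proper_nontrivial Pi.
have [Pi1 /andP[part1 prop1] max1] := @arg_maxP _ _ _ Pi0 P F Pi0P.
exists r, (fun=> F Pi1); split.
  move/(expect_gt0 (jeffrey_posterior ps p_gt0 part1)).
  by rewrite expectB expect_cst FE subrr ltxx.
split=> [|Pi partPi propPi].
  (* The maximizer [Pi1] is itself proper non-trivial, so the blind spot makes the inequality
     strict. *)
  by rewrite expect_cst FE; apply/expect_likelihood_ratio_lt/blind.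
rewrite expectB expect_cst -FE subr_le0; apply: max1.
by rewrite /P partPi.
Qed.
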